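(* The $\chi^2$ distribution family has the hierarchical low-rank property. That is, for every $\epsilon>0$ there exists a positive integer $T_\epsilon$, with $T_\epsilon=O(\mathrm{polylog}(1/\epsilon))$, such that for every integer $\ell$ and every integer $j\ge 0$, there exist real-valued functions $\alpha_i(x)$ and $\beta_i(k)$, $1\le i\le T_\epsilon$ (which may depend on $\epsilon,\ell,j$), such that for all real $x>0$ and integers $k\ge 1$ with $\left(\tfrac{x}{2},\tfrac{k}{2}-1\right)\in B_{\ell,j}$ $$\frac{1}{2^{k/2}\Gamma(k/2)}x^{k/2-1}e^{-x/2}=\sum_{i=1}^{T_\epsilon}\alpha_i(x)\beta_i(k)+O(\epsilon).$$
   Context: The left-hand side is the density at $x>0$ of the $\chi^2$ distribution with $k$ degrees of freedom; $\Gamma$ is the Gamma function. For each integer $\ell$ and each integer $j\ge 0$, the block $B_{\ell,j}\subset[0,\infty)^2$ is $$B_{\ell,j}=\begin{cases}[j/2^\ell,(j+1)/2^\ell]\times[(j+1)/2^\ell,(j+2)/2^\ell], & j\text{ even},\\ [j/2^\ell,(j+1)/2^\ell]\times[(j-1)/2^\ell,j/2^\ell], & j\text{ odd}.\end{cases}$$ Asymptotic notation: $T_\epsilon=O(\mathrm{polylog}(1/\epsilon))$ means that there are absolute constants $A,m>0$ with $T_\epsilon\le A(\ln(1/\epsilon))^m$ for all $0<\epsilon\le 1/2$. The error term $O(\epsilon)$ denotes a quantity of absolute value at most $C\epsilon$, with $C$ an absolute constant independent of $\epsilon,\ell,j,x,k$. *)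

(* Defs.v *)
From mathcomp Require Import all_boot all_order all_algebra.
From mathcomp Require Import all_classical all_reals all_analysis.

Set Implicit Arguments.
Unset Strict Implicit.
Unset Printing Implicit Defensive.

Import Order.TTheory GRing.Theory Num.Theory.
Import numFieldNormedType.Exports.

Local Open Scope classical_set_scope.
Local Open Scope ring_scope.

(* Euler's integral. [Rintegral] is [0] when the Lebesgue integral is infinite,
   so this is the Gamma function for [0 < s] only. *)
Definition Gamma (R : realType) (s : R) : R :=
  \int[@lebesgue_measure R]_(t in `]0, +oo[) (t `^ (s - 1) * expR (- t)).

Definition chi2_pdf (R : realType) (k : nat) (x : R) : R :=
  (2 `^ (k%:R / 2) * Gamma (k%:R / 2))^-1
    * x `^ (k%:R / 2 - 1) * expR (- x / 2).

(* [2 ^ l] is the power with a signed integer exponent. For odd [j], [j%:R - 1]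
   is a subtraction in [R]. *)
Definition block (R : realType) (l : int) (j : nat) : set (R * R) :=
  if odd j then
    `[j%:R / 2 ^ l, (j%:R + 1) / 2 ^ l] `*` `[(j%:R - 1) / 2 ^ l, j%:R / 2 ^ l]
  else
    `[j%:R / 2 ^ l, (j%:R + 1) / 2 ^ l]
      `*` `[(j%:R + 1) / 2 ^ l, (j%:R + 2) / 2 ^ l].

(* [T eps = O(polylog(1/eps))] *)
Definition polylog_bounded (R : realType) (T : R -> nat) : Prop :=
  exists A m : R, [/\ 0 < A, 0 < m &
    forall eps : R, 0 < eps -> eps <= 1 / 2 ->
      (T eps)%:R <= A * ln (1 / eps) `^ m].

(* Main.v *)
Require Import Defs.
From mathcomp Require Import all_boot all_order all_algebra.
From mathcomp Require Import all_classical all_reals all_analysis.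
From mathcomp Require Import measurable_realfun ring lra.

Import Order.TTheory GRing.Theory Num.Theory.
Import numFieldNormedType.Exports.

Local Open Scope classical_set_scope.
Local Open Scope ring_scope.

(** Put [y = x / 2] and [s = k / 2 - 1], so the density is
    [y ^ s * exp (- y) / (2 * Gamma (s + 1))]. A block touches the diagonal at a
    corner [(c, c)], with [y] and [s] on opposite sides of [c] and both at most
    [2 * c]. Let [n] be about [ln (1 / eps)]. If [c = O(n)], the block meets only
    [O(n)] values of [k], and the density is trivially a sum of that many
    products. Otherwise the bound [exp (- (sqrt y - sqrt s) ^ 2)] confines the
    density to [|y - c|, |s - c| <= sqrt (8 * n * c)], where it is a product
    times [exp ((s - c) * ln (y / c))] with exponent [O(n)]; [O(n)] terms of
    the exponential series then suffice. *)

(** * Tail of the exponential series *)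

Lemma expR1_le4 (R : realType) : expR 1 <= 4 :> R.
Proof.
(* Inverting [1 - 1 / 2 <= exp (- 1 / 2)] gives this bound; its square is the claim. *)
have half : expR (1 / 2) <= 2 :> R.
  have := expR_ge1Dx (- (1 / 2) : R); rewrite expRN => h.
  have e0 := expR_gt0 (1 / 2 : R).
  have : (1 - 1 / 2) * expR (1 / 2) <= 1 :> R.
    by rewrite -ler_pdivlMr// [leRHS]div1r.
  by lra.
have -> : 1 = 1 / 2 + 1 / 2 :> R by lra.
by rewrite expRD; have := expR_ge0 (1 / 2 : R); nra.
Qed.

Lemma series_exp_coeff_le_expR (R : realType) (x : R) (n : nat) :
  0 <= x -> series (exp_coeff x) n <= expR x.
Proof.
move=> x0; rewrite /expR.
apply: (@nondecreasing_cvgn_le R (series (exp_coeff x))); last first.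
  exact: is_cvg_series_exp_coeff.
by apply: nondecreasing_series => i _ _; exact: exp_coeff_ge0.
Qed.

(* Chernoff-style: on the tail [i >= N] the weight [expR 1 ^+ (i - N)] is at
   least 1, and inserting it turns the tail into part of [expR (expR 1 * `|z|)]. *)
Lemma expR_taylor_remainder (R : realType) (z : R) (N : nat) :
  `|expR z - \sum_(i < N) z ^+ i / i`!%:R|
    <= expR (expR 1 * `|z| - N%:R).
Proof.
have cvz := is_cvg_series_exp_coeff z.
have -> : \sum_(i < N) z ^+ i / i`!%:R = series (exp_coeff z) N.
  by rewrite /series /= big_mkord.
have cvd : (series (exp_coeff z) M - series (exp_coeff z) N) @[M --> \oo]
    --> expR z - series (exp_coeff z) N.
  by apply: cvgB; [exact: cvz | exact: cvg_cst].
rewrite -(cvg_lim _ (cvg_norm cvd))//.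
apply: limr_le.
  by apply: cvgP; exact: (cvg_norm cvd).
near=> M.
have NM : (N <= M)%N by near: M; exact: nbhs_infty_ge.
rewrite sub_series_geq//.
apply: (le_trans (ler_norm_sum _ _ _)).
rewrite expRD mulrC.
apply: (@le_trans _ _ (expR (- N%:R) *
    \sum_(N <= i < M) exp_coeff (expR 1 * `|z|) i)).
  rewrite mulr_sumr !big_nat; apply: ler_sum => i /andP[Ni _].
  rewrite /exp_coeff /= normrM normrX normfV [`|i`!%:R|]ger0_norm// mulrA.
  apply: ler_wpM2r; first by rewrite invr_ge0.
  rewrite exprMn mulrA -expRM_natl -expRD; apply: ler_peMl.
    exact: exprn_ge0.
  rewrite -[leLHS]expR0 ler_expR mulr1 addrC subr_ge0.
  by rewrite ler_nat.
apply: ler_wpM2l; first exact: expR_ge0.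
apply: (le_trans _ (@series_exp_coeff_le_expR _ _ M _)); last first.
  by rewrite mulr_ge0 ?expR_ge0.
rewrite /series /= [leRHS](@big_cat_nat _ _ _ N)//= lerDr.
by apply: sumr_ge0 => i _; apply: exp_coeff_ge0; rewrite mulr_ge0 ?expR_ge0.
Unshelve. all: by end_near.
Qed.

(** * Upper bound on the density *)

(* [Gamma] is [0] by convention if Euler's integral is infinite, so admitting
   this value spares a convergence proof: [chi2_pdf] vanishes with it. *)
Lemma Gamma_eq0_or_ge (R : realType) (s g : R) : 0 <= s -> 0 <= g ->
  (forall t, s < t -> t <= s + 1 -> g <= t `^ s * expR (- t)) ->
  Gamma (s + 1) = 0 \/ g <= Gamma (s + 1).
Proof.
move=> s0 g0 gle; rewrite /Gamma /Rintegral addrK.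
set f := fun t : R => t `^ s * expR (- t).
have mf D : measurable_fun D f.
  apply: measurable_funTS; apply: measurable_funM.
    exact: measurable_powR.
  by apply: measurableT_comp => //; exact: measurable_expR.
have mfE D : measurable_fun D (fun t => (f t)%:E).
  by apply/measurable_EFinP.
have f0 t : (0 <= (f t)%:E)%E by rewrite lee_fin mulr_ge0 ?powR_ge0 ?expR_ge0.
have gI : (g%:E <= \int[lebesgue_measure]_(t in `]0%R, +oo[) (f t)%:E)%E.
  apply: (@le_trans _ _ (\int[lebesgue_measure]_(t in `]s, (s + 1)%R]) (f t)%:E)%E).
    apply: (@le_trans _ _ (\int[lebesgue_measure]_(t in `]s, (s + 1)%R]) (cst g%:E t))%E).
      rewrite integral_cst//= lebesgue_measure_itv/= lte_fin ltrDl ltr01.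
      by rewrite -EFinB addrAC subrr add0r mule1.
    apply: ge0_le_integral => //=.
      exact: mfE.
    by move=> t /=; rewrite in_itv/= => /andP[? ?]; rewrite lee_fin; exact: gle.
  apply: ge0_subset_integral => //=; first exact: mfE.
  move=> t /=; rewrite !in_itv/= andbT => /andP[st _].
  exact: le_lt_trans st.
move: gI; case: (\int[lebesgue_measure]_(t in `]0%R, +oo[) (f t)%:E)%E => [r||] //=.
  by rewrite lee_fin; right.
by left.
Qed.

(** For [s > 0], replacing [ln t] by the smaller [ln s] leaves [ln (y / s)], twice the logarithm of
    [sqrt y / sqrt s]; then [ln u <= u - 1] applies. *)
Lemma xlnx_ratio_le (R : realType) (s y t : R) : 0 <= s -> 0 < y -> s < t ->
  s * (ln y - ln t) <= 2 * (Num.sqrt y * Num.sqrt s) - 2 * s.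
Proof.
move=> s0 y0 st; have t0 := le_lt_trans s0 st.
move: s0; rewrite le_eqVlt => /predU1P[<-|s0].
  by rewrite sqrtr0; lra.
have lst : ln s <= ln t by rewrite ler_ln ?posrE// ltW.
apply: (@le_trans _ _ (s * (ln y - ln s))).
  by apply: ler_wpM2l; [exact: ltW | lra].
have a0 : 0 < Num.sqrt y by rewrite sqrtr_gt0.
have b0 : 0 < Num.sqrt s by rewrite sqrtr_gt0.
rewrite -{1}(sqr_sqrtr (ltW y0)) -{2 4}(sqr_sqrtr (ltW s0)).
rewrite -{1}(sqr_sqrtr (ltW s0)).
move: (Num.sqrt y) (Num.sqrt s) a0 b0 => a b a0 b0.
rewrite !lnXn// -mulrnBl -ln_div ?posrE//.
have : ln (a / b) <= a / b - 1.
  have ab : 0 < a / b by rewrite divr_gt0.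
  by have := @le_ln1Dx R (a / b - 1); rewrite [1 + _]addrC subrK; apply; lra.
move=> h.
have : b ^+ 2 * ln (a / b) <= b ^+ 2 * (a / b - 1).
  by apply: ler_wpM2l => //; exact: sqr_ge0.
have -> : b ^+ 2 * (a / b - 1) = a * b - b ^+ 2.
  by rewrite mulrBr mulr1 expr2 mulrACA mulfV ?mulr1 1?mulrC ?gt_eqF// mulrC.
by rewrite mulr2n; lra.
Qed.

Lemma chi2_pdfE (R : realType) (k : nat) (x : R) : 0 < x ->
  chi2_pdf k x = (Gamma (k%:R / 2))^-1
    * expR ((k%:R / 2 - 1) * ln (x / 2) - x / 2 - ln 2).
Proof.
move=> x0; rewrite /chi2_pdf /powR !gt_eqF// invfM -expRN.
rewrite [expR _ / _]mulrC -!mulrA -!expRD ln_div ?posrE//.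
by congr (_ * expR _); lra.
Qed.

Lemma chi2_pdf_ge0 (R : realType) (k : nat) (x : R) : 0 <= chi2_pdf k x.
Proof.
rewrite /chi2_pdf !mulr_ge0 ?expR_ge0 ?powR_ge0// invr_ge0.
rewrite mulr_ge0 ?powR_ge0// /Gamma.
by apply: Rintegral_ge0 => t _; rewrite mulr_ge0 ?powR_ge0 ?expR_ge0.
Qed.

(** With [d] the squared difference of the roots, the integrand of [Gamma (s + 1)] is at least
    [y ^ s * exp (- y) * exp (d - 1)] on []s, s + 1]]; the 1 pays for [t <= s + 1]. *)
Lemma chi2_pdf_le (R : realType) (k : nat) (x : R) :
  0 < x -> 0 <= k%:R / 2 - 1 :> R ->
  chi2_pdf k x <=
    expR (1 - (Num.sqrt (x / 2) - Num.sqrt (k%:R / 2 - 1)) ^+ 2).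
Proof.
move=> x0; rewrite chi2_pdfE//; set s := k%:R / 2 - 1; set y := x / 2 => s0.
have y0 : 0 < y by rewrite divr_gt0.
have -> : k%:R / 2 = s + 1 :> R by rewrite subrK.
have hy := sqr_sqrtr (ltW y0); have hs := sqr_sqrtr s0.
set d := (Num.sqrt y - Num.sqrt s) ^+ 2.
have dE : d = y + s - 2 * (Num.sqrt y * Num.sqrt s).
  by rewrite /d sqrrB hy hs mulr2n; lra.
have ln2 : 0 <= ln 2 :> R by rewrite ln_ge0// ler1n.
pose g := expR (s * ln y - y - 1 + d).
have g0 : 0 < g by exact: expR_gt0.
have [->|gG] : Gamma (s + 1) = 0 \/ g <= Gamma (s + 1).
- apply: Gamma_eq0_or_ge => // [|t st ts]; first exact: ltW.
  have t0 := le_lt_trans s0 st.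
  rewrite /powR gt_eqF// -expRD ler_expR dE.
  by have := @xlnx_ratio_le R s y t s0 y0 st; lra.
- by rewrite invr0 mul0r expR_ge0.
have G0 := lt_le_trans g0 gG.
rewrite mulrC ler_pdivrMr//.
apply: (@le_trans _ _ (expR (1 - d) * g)).
  by rewrite -expRD ler_expR; lra.
by apply: ler_wpM2l => //; exact: expR_ge0.
Qed.

(** * Estimates around the corner of a block *)

Lemma normr_ln_le (R : realType) (w : R) : 1 / 2 <= w ->
  `|ln w| <= 2 * `|w - 1|.
Proof.
move=> w12; have w0 : 0 < w by lra.
have up : ln w <= w - 1.
  by have := @le_ln1Dx R (w - 1); rewrite [1 + _]addrC subrK; apply; lra.
have lo : - ln w <= 2 * `|w - 1|.
  have v0 : 0 < w^-1 by rewrite invr_gt0.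
  rewrite -lnV ?posrE//.
  have h : ln w^-1 <= w^-1 - 1.
    by have := @le_ln1Dx R (w^-1 - 1); rewrite [1 + _]addrC subrK; apply; lra.
  apply: (le_trans h).
  have -> : w^-1 - 1 = (1 - w) * w^-1 by rewrite mulrBl mul1r mulfV ?gt_eqF.
  rewrite ler_pdivrMr//.
  by case: (ger0P (w - 1)) => h1; nra.
rewrite ler_norml; apply/andP; split; first by lra.
by have := ler_norm (w - 1); have := normr_ge0 (w - 1); lra.
Qed.

Lemma normr_mul_le_of_sqr (R : realDomainType) (a b m : R) :
  a ^+ 2 <= m -> b ^+ 2 <= m -> `|a| * `|b| <= m.
Proof.
rewrite -(real_normK (num_real a)) -(real_normK (num_real b)) => ha hb.
by have := sqr_ge0 (`|a| - `|b|); nra.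
Qed.

Lemma window_exponent_le (R : realType) (c y s m : R) :
  0 < c -> 0 <= m -> 4 * m < c ->
  (y - c) ^+ 2 <= m * c -> (s - c) ^+ 2 <= m * c ->
  0 < y /\ `|(s - c) * ln (y / c)| <= 2 * m.
Proof.
move=> c0 m0 mc hy hs.
(* Here [(y - c) ^ 2 <= m * c < c ^ 2 / 4], which puts [y / c] in the range of [normr_ln_le]. *)
have yc : c / 2 <= y by rewrite leNgt; apply/negP => h; nra.
split; first by lra.
have w12 : 1 / 2 <= y / c by rewrite ler_pdivlMr//; lra.
rewrite normrM.
apply: (@le_trans _ _ (`|s - c| * (2 * (`|y - c| / c)))).
  apply: ler_wpM2l => //; apply: (le_trans (@normr_ln_le _ _ w12)).
  have -> : y / c - 1 = (y - c) / c by rewrite mulrBl mulfV ?gt_eqF.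
  by rewrite normrM normfV (gtr0_norm c0).
have -> : `|s - c| * (2 * (`|y - c| / c)) = 2 * (`|s - c| * `|y - c|) / c.
  by rewrite mulrCA !mulrA.
rewrite ler_pdivrMr// -mulrA.
by have := @normr_mul_le_of_sqr _ _ _ _ hs hy; lra.
Qed.

(* Since [(sqrt y - sqrt s) * (sqrt y + sqrt s) = y - s] and
   [(sqrt y + sqrt s) ^ 2 <= 2 * (y + s) <= 8 * c]. *)
Lemma sqr_sqrt_diff_ge (R : rcfType) (c y s m : R) :
  0 < c -> 0 <= y -> 0 <= s -> y <= 2 * c -> s <= 2 * c ->
  8 * m * c <= (y - s) ^+ 2 -> m <= (Num.sqrt y - Num.sqrt s) ^+ 2.
Proof.
move=> c0 y0 s0 y2 s2.
rewrite -{1}(sqr_sqrtr y0) -{1}(sqr_sqrtr s0) subr_sqr exprMn.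
have := sqr_sqrtr y0; have := sqr_sqrtr s0.
move: (Num.sqrt y) (Num.sqrt s) => a b hb ha h.
have ab : (a + b) ^+ 2 <= 8 * c by have := sqr_ge0 (a - b); nra.
rewrite leNgt; apply/negP => dm.
have : (a - b) ^+ 2 * (a + b) ^+ 2 <= (a - b) ^+ 2 * (8 * c).
  by apply: ler_wpM2l => //; exact: sqr_ge0.
by nra.
Qed.

(** * Low-rank sums for large and small corners *)

(* [s * ln y = s * ln c + c * ln (y / c) + (s - c) * ln (y / c)], and only the
   last term couples the variables. *)
Lemma chi2_pdf_lowrank_corner (R : realType) (c : R) (n T : nat) :
  32 * n%:R < c -> (130 * n <= T)%N ->
  exists (alpha : 'I_T -> R -> R) (beta : 'I_T -> nat -> R),
    forall (x : R) (k : nat), 0 < x -> 0 <= k%:R / 2 - 1 :> R ->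
      x / 2 <= 2 * c -> k%:R / 2 - 1 <= 2 * c ->
      (x / 2 - c) * (k%:R / 2 - 1 - c) <= 0 ->
      `|chi2_pdf k x - \sum_(i < T) alpha i x * beta i k| <= expR (1 - n%:R).
Proof.
move=> nc nT.
have n0 : 0 <= n%:R :> R by [].
have c0 : 0 < c by lra.
(* The 8 is that of [sqr_sqrt_diff_ge], for decay [exp (- n)] outside the window; inside,
   [32 * n < c] is [4 * m < c] with [m = 8 * n]. *)
pose near_c (u : R) := (u - c) ^+ 2 <= 8 * n%:R * c.
exists (fun i x => if near_c (x / 2) then
    expR (c * ln (x / 2 / c) - x / 2 - ln 2) * ln (x / 2 / c) ^+ i / i`!%:R
  else 0).
exists (fun i k => if near_c (k%:R / 2 - 1) then
    (Gamma (k%:R / 2))^-1 * expR ((k%:R / 2 - 1) * ln c)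
      * (k%:R / 2 - 1 - c) ^+ i
  else 0).
move=> x k x0; set s := k%:R / 2 - 1; set y := x / 2 => s0 y2 s2 ys.
have y0 : 0 < y by rewrite divr_gt0.
have [/andP[ny ns]|far] := boolP (near_c y && near_c s); last first.
  rewrite big1 ?subr0; last first.
    move=> i _; move: far; rewrite negb_and.
    by case: (near_c y) => //= [/negPf ->|_]; rewrite ?mulr0 ?mul0r.
  rewrite ger0_norm ?chi2_pdf_ge0//.
  apply: (le_trans (@chi2_pdf_le _ _ _ x0 s0)).
  rewrite ler_expR lerD2l lerN2.
  apply: (@sqr_sqrt_diff_ge _ c) => //; first exact: ltW.
  have : 8 * n%:R * c < (y - c) ^+ 2 \/ 8 * n%:R * c < (s - c) ^+ 2.
    by move: far; rewrite negb_and -!ltNge => /orP.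
  (* As [y] and [s] lie on opposite sides of [c], the cross term only helps: one large deviation
     suffices. *)
  have -> : (y - s) ^+ 2 = (y - c) ^+ 2 + (s - c) ^+ 2 - 2 * ((y - c) * (s - c)).
    by ring.
  by have := sqr_ge0 (y - c); have := sqr_ge0 (s - c); move=> ? ? []; lra.
rewrite ny ns.
have [_ zle] : 0 < y /\ `|(s - c) * ln (y / c)| <= 2 * (8 * n%:R).
  by apply: window_exponent_le => //; lra.
set z := (s - c) * ln (y / c) in zle.
pose AB := expR (c * ln (y / c) - y - ln 2)
  * ((Gamma (k%:R / 2))^-1 * expR (s * ln c)).
have -> : \sum_(i < T) expR (c * ln (y / c) - y - ln 2) * ln (y / c) ^+ i
      / i`!%:R * ((Gamma (k%:R / 2))^-1 * expR (s * ln c) * (s - c) ^+ i)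
    = AB * \sum_(i < T) z ^+ i / i`!%:R.
  rewrite mulr_sumr; apply: eq_bigr => i _.
  by rewrite /AB /z exprMn; ring.
have fE : chi2_pdf k x = AB * expR z.
  rewrite chi2_pdfE// /AB -/s -/y mulrCA -[RHS]mulrA; congr (_ * _).
  rewrite -!expRD; congr expR.
  by rewrite /z [ln (y / c)]ln_div ?posrE//; ring.
(* This bounds [AB] through the density, at the cost of a factor [exp |z|]. *)
have ABE : AB = chi2_pdf k x * expR (- z).
  by rewrite fE -mulrA -expRD subrr expR0 mulr1.
rewrite {1}fE -mulrBr normrM {1}ABE normrM (ger0_norm (chi2_pdf_ge0 _ _ _)).
rewrite (ger0_norm (expR_ge0 _)) -mulrA.
apply: (@le_trans _ _ (expR 1 * expR (- n%:R))); last by rewrite -expRD.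
apply: ler_pM => //; first exact: chi2_pdf_ge0.
  apply: (le_trans (@chi2_pdf_le _ _ _ x0 s0)).
  by rewrite ler_expR gerBl sqr_ge0.
apply: (@le_trans _ _ (expR (- z) * expR (expR 1 * `|z| - T%:R))).
  by apply: ler_wpM2l; [exact: expR_ge0 | exact: expR_taylor_remainder].
rewrite -expRD ler_expR.
(* From [|z| <= 16 * n] and [exp 1 <= 4], the positive part of the exponent is at most [80 * n]. *)
have : 130 * n%:R <= T%:R :> R by rewrite -natrM ler_nat.
have := ler_norm (- z); rewrite normrN.
have := @expR1_le4 R; have := normr_ge0 z.
by nra.
Qed.

(** Every admissible [k] is below [T], so a Kronecker delta in [k] selects the exact density. *)
Lemma chi2_pdf_lowrank_small (R : realType) (c : R) (T : nat) :
  4 * c + 2 < T%:R ->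
  exists (alpha : 'I_T -> R -> R) (beta : 'I_T -> nat -> R),
    forall (x : R) (k : nat), k%:R / 2 - 1 <= 2 * c ->
      chi2_pdf k x = \sum_(i < T) alpha i x * beta i k.
Proof.
move=> cT; exists (fun i x => chi2_pdf i x), (fun i k => (val i == k)%:R).
move=> x k kc.
have kT : (k < T)%N by rewrite -(ltr_nat R); lra.
rewrite (bigD1 (Ordinal kT))//= eqxx mulr1 big1 ?addr0// => i ik.
by rewrite (negPf (ik : val i != k)) mulr0.
Qed.

(** * Corner of a block and choice of constants *)

(** The corner is at distance at least one side length from 0, hence the factor 2; for odd [j] this
    rests on [j >= 1], which also gives [0 <= s]. *)
Lemma block_corner (R : realType) (l : int) (j : nat) :
  exists2 c : R, 0 < c & forall y s, block l j (y, s) ->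
    [/\ 0 <= s, y <= 2 * c, s <= 2 * c & (y - c) * (s - c) <= 0].
Proof.
have p0 : 0 < 2 ^ l :> R by rewrite exprz_gt0.
have h0 : 0 < (2 ^ l)^-1 :> R by rewrite invr_gt0.
rewrite /block; move: (2 ^ l)^-1 h0 => h h0.
have j0 : 0 <= j%:R :> R by [].
case: ifPn => oj.
  have j1 : 1 <= j%:R :> R by rewrite ler1n; case: j oj {j0}.
  exists (j%:R * h); first by rewrite mulr_gt0//; lra.
  move=> y s [/=]; rewrite !in_itv/= => /andP[? ?] /andP[? ?].
  by split; nra.
exists ((j%:R + 1) * h); first by rewrite mulr_gt0//; lra.
move=> y s [/=]; rewrite !in_itv/= => /andP[? ?] /andP[? ?].
by split; nra.
Qed.

Theorem mainTheorem7 (R : realType) :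
  exists (T : R -> nat) (C : R),
    [/\ forall eps : R, 0 < eps -> (0 < T eps)%N,
        polylog_bounded T &
        forall (eps : R), 0 < eps ->
        forall (l : int) (j : nat),
          exists (alpha : 'I_(T eps) -> R -> R) (beta : 'I_(T eps) -> nat -> R),
            forall (x : R) (k : nat), 0 < x -> (1 <= k)%N ->
              block l j (x / 2, k%:R / 2 - 1) ->
              `| chi2_pdf k x - \sum_(i < T eps) alpha i x * beta i k |
                <= C * eps].
Proof.
(* The successor ensures [n >= 1] and [n > ln (1 / eps)], also for [eps >= 1]. *)
pose n (eps : R) := (Num.truncn (ln (1 / eps))).+1.
(* A small corner [c <= 32 * n] needs [128 * n + 2 < T]; a large one needs [130 * n <= T]. *)
exists (fun eps => 131 * n eps)%N, (expR 1); split.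
- by move=> eps _; rewrite muln_gt0.
(* With [L = ln (1 / eps) >= 1 / 2], [n <= L + 1 <= 3 * L], and [393 = 131 * 3]. *)
- exists 393, 1; split => // eps e0 e12.
  have il : 1 / 2 <= ln (1 / eps).
    rewrite [1 / eps]div1r lnV ?posrE//.
    have := @le_ln1Dx R (eps - 1); rewrite [1 + _]addrC subrK => h.
    by have := h ltac:(lra); lra.
  rewrite powRr1; last by lra.
  have tr : (Num.truncn (ln (1 / eps)))%:R <= ln (1 / eps).
    by rewrite truncn_le; lra.
  by rewrite natrM /n -natr1; lra.
move=> eps e0 l j.
have [c c0 cP] := block_corner R l j.
have n1 : 1 <= (n eps)%:R :> R by rewrite ler1n.
have [cn|cn] := lerP c (32 * (n eps)%:R).
  have [|a [b abP]] := @chi2_pdf_lowrank_small R c (131 * n eps).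
    by rewrite natrM; lra.
  exists a, b => x k x0 k1 /cP[_ _ sc _].
  by rewrite -abP// subrr normr0 mulr_ge0 ?expR_ge0// ltW.
have nT : (130 * n eps <= 131 * n eps)%N by rewrite leq_mul2r orbT.
have [a [b abP]] := @chi2_pdf_lowrank_corner R c _ _ cn nT.
exists a, b => x k x0 k1 /cP[s0 y2 s2 ys].
apply: le_trans (abP _ _ x0 s0 y2 s2 ys) _.
rewrite expRD ler_wpM2l ?expR_ge0//.
rewrite -[leRHS](lnK (e0 : eps \is Num.pos)) ler_expR lerNl -lnV ?posrE//.
by rewrite -div1r ltW// truncnS_gt.
Qed.
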